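(* Let $\mu$ be a quasi-definite complex Borel measure on $\mathbb{T}^D$ with moment matrix factorization $G=S^{-1}H(\hat S^{-1})^\dagger$. Then: (1) $\eta H\eta=H^\top$ and $\overline{\hat S}=\eta S\eta$; if $\mu$ is a real measure, then $\eta H\eta=\overline H$. (2) $\eta\beta\eta=\overline{\hat\beta}$. (3) $\eta\Phi(z)=\bar{\hat\Phi}(z^{-1})$ and $\eta\hat\Phi(z)=\bar\Phi(z^{-1})$ for all $z\in(\mathbb{C}^* )^D$.
   Context: Let $D\ge1$, $z(\theta)=(e^{i\theta_1},\dots,e^{i\theta_D})$. For $\alpha\in\mathbb{Z}^D$ put $|\alpha|=\sum_a|\alpha_a|$, $z^\alpha=\prod_a z_a^{\alpha_a}$, $[k]=\{\alpha:|\alpha|=k\}$. Multi-indices are ordered by longitude $|\alpha|$ and lexicographically inside each $[k]$; $\chi(z)$ is the semi-infinite column vector of all monomials $z^\alpha$ in this order. Semi-infinite matrices have the corresponding block structure $A_{[k],[l]}$, and $A^{[k]}$ denotes truncation to blocks $0,\dots,k-1$. The moment matrix is $G=\oint_{\mathbb{T}^D}\chi(z(\theta))d\mu(\theta)\chi(z(\theta))^\dagger$. The measure is quasi-definite if $\det G^{[k]}\ne0$ for all $k\ge1$; then uniquely $G=S^{-1}H(\hat S^{-1})^\dagger$ with $S,\hat S$ block lower unitriangular and $H$ block diagonal with invertible blocks. Put $\Phi=S\chi$, $\hat\Phi=\hat S\chi$. The matrix $\beta$ (resp. $\hat\beta$) is the first block subdiagonal of $S$ (resp. $\hat S$): its only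 nonzero blocks are $\beta_{[k],[k-1]}=S_{[k],[k-1]}$ (resp. $\hat S_{[k],[k-1]}$), $k\ge1$. The reversal matrix $\eta$ is the block diagonal matrix whose $k$-th diagonal block is the $|[k]|\times|[k]|$ exchange matrix (ones on the antidiagonal, zeros elsewhere); equivalently $\eta_{\alpha,\beta}=\delta_{\alpha,-\beta}$. A bar over a matrix is entrywise complex conjugation; $\bar\Phi(z)=\overline{S}\chi(z)$, $\bar{\hat\Phi}(z)=\overline{\hat S}\chi(z)$ (conjugation of coefficients only). $z^{-1}=(z_1^{-1},\dots,z_D^{-1})$. *)

(* Defs.v *)
From HB Require Import structures.
From mathcomp Require Import all_boot all_order all_algebra finmap.
From mathcomp Require Import complex zify.
From mathcomp Require Import all_classical all_reals all_analysis.

Set Implicit Arguments.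
Unset Strict Implicit.
Unset Printing Implicit Defensive.

Import Order.TTheory GRing.Theory Num.Theory.
Import numFieldNormedType.Exports.

Local Open Scope classical_set_scope.
Local Open Scope complex_scope.
Local Open Scope ring_scope.

(* Complex measures: sigma-additive R[i]-valued set functions.  [R[i]^o] is
   R[i] with the topology of its norm. *)
Record complex_measure (R : realType) d (T : measurableType d) :=
  ComplexMeasure {
    cmeas :> set T -> R[i];
    cmeas0 : cmeas set0 = 0;
    cmeas_sigma_additive : forall F : nat -> set T,
      (forall n, measurable (F n)) -> trivIset setT F ->
      (fun n => \sum_(0 <= i < n) cmeas (F i) : R[i]^o) @ \oo
        --> (cmeas (\bigcup_n F n) : R[i]^o) }.

Definition real_measure (R : realType) d (T : measurableType d)
    (mu : complex_measure R T) : Prop :=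
  forall A, measurable A -> complex.Im (mu A) = 0.

Definition cmeas_Re (R : realType) d (T : measurableType d)
  (mu : complex_measure R T) (A : set T) : \bar R := (complex.Re (mu A))%:E.

Definition cmeas_Im (R : realType) d (T : measurableType d)
  (mu : complex_measure R T) (A : set T) : \bar R := (complex.Im (mu A))%:E.

Section parts_are_charges.
Variables (R : realType) (d : measure_display) (T : measurableType d).
Variable mu : complex_measure R T.

Lemma Re_sum (I : Type) (s : seq I) (f : I -> R[i]) :
  complex.Re (\sum_(i <- s) f i) = \sum_(i <- s) complex.Re (f i).
Proof. by apply: (big_morph (@complex.Re R)) => // -[a b] [c e]. Qed.

Lemma Im_sum (I : Type) (s : seq I) (f : I -> R[i]) :
  complex.Im (\sum_(i <- s) f i) = \sum_(i <- s) complex.Im (f i).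
Proof. by apply: (big_morph (@complex.Im R)) => // -[a b] [c e]. Qed.

Lemma Re_le_norm (x : R[i]) : (`|complex.Re x|%:C <= `|x|)%R.
Proof.
case: x => a b; rewrite normc_def lecR /= -sqrtr_sqr ler_wsqrtr //.
by rewrite lerDl sqr_ge0.
Qed.

Lemma Im_le_norm (x : R[i]) : (`|complex.Im x|%:C <= `|x|)%R.
Proof.
case: x => a b; rewrite normc_def lecR /= -sqrtr_sqr ler_wsqrtr //.
by rewrite lerDr sqr_ge0.
Qed.

Lemma Re_continuous : continuous (fun x : R[i]^o => complex.Re x : R).
Proof.
move=> x; have FF : Filter (nbhs (x : R[i]^o)) by exact: nbhs_filter.
apply/(@cvgrPdist_lt _ _ _ (nbhs (x : R[i]^o)) FF) => e e0; exists e%:C => /=; first by rewrite ltcR.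
move=> y /= xy; rewrite -ltcR; apply: le_lt_trans xy.
by have := Re_le_norm (x - y); case: (x) => ? ?; case: (y).
Qed.

Lemma Im_continuous : continuous (fun x : R[i]^o => complex.Im x : R).
Proof.
move=> x; have FF : Filter (nbhs (x : R[i]^o)) by exact: nbhs_filter.
apply/(@cvgrPdist_lt _ _ _ (nbhs (x : R[i]^o)) FF) => e e0; exists e%:C => /=; first by rewrite ltcR.
move=> y /= xy; rewrite -ltcR; apply: le_lt_trans xy.
by have := Im_le_norm (x - y); case: (x) => ? ?; case: (y).
Qed.

Let Re0 : cmeas_Re mu set0 = 0%E. Proof. by rewrite /cmeas_Re cmeas0. Qed.
Let Im0 : cmeas_Im mu set0 = 0%E. Proof. by rewrite /cmeas_Im cmeas0. Qed.

Let Re_fin A : measurable A -> cmeas_Re mu A \is a fin_num. Proof. by []. Qed.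
Let Im_fin A : measurable A -> cmeas_Im mu A \is a fin_num. Proof. by []. Qed.

Let Re_sigma : measure_function.semi_sigma_additive (cmeas_Re mu).
Proof.
move=> F mF tF _; have /= h := cvg_comp _ _ (@cmeas_sigma_additive _ _ _ mu _ mF tF)
  (@Re_continuous _).
rewrite (_ : (fun n => _) = (fun n => (complex.Re (\sum_(0 <= i < n) mu (F i)))%:E)).
  by apply: cvg_EFin; [exact: nearW | exact: h].
by apply/funext => n; rewrite Re_sum -sumEFin.
Qed.

Let Im_sigma : measure_function.semi_sigma_additive (cmeas_Im mu).
Proof.
move=> F mF tF _; have /= h := cvg_comp _ _ (@cmeas_sigma_additive _ _ _ mu _ mF tF)
  (@Im_continuous _).
rewrite (_ : (fun n => _) = (fun n => (complex.Im (\sum_(0 <= i < n) mu (F i)))%:E)).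
  by apply: cvg_EFin; [exact: nearW | exact: h].
by apply/funext => n; rewrite Im_sum -sumEFin.
Qed.

HB.instance Definition _ :=
  isCharge.Build d T R (cmeas_Re mu) Re0 Re_fin Re_sigma.
HB.instance Definition _ :=
  isCharge.Build d T R (cmeas_Im mu) Im0 Im_fin Im_sigma.

End parts_are_charges.

(* The Hahn decomposition is unique up to null sets, hence the integral below
   does not depend on the one that is chosen. *)
Definition charge_integral (R : realType) d (T : measurableType d)
    (nu : {charge set T -> \bar R}) (f : T -> R) : R :=
  let P := cid (Hahn_decomposition nu) in
  let N := cid (projT2 P) in
  (\int[jordan_pos (projT2 N)]_x f x) - (\int[jordan_neg (projT2 N)]_x f x).

Definition complex_integral (R : realType) d (T : measurableType d)
    (mu : complex_measure R T) (f : T -> R[i]) : R[i] :=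
  let I nu (g : T -> R) := charge_integral nu g in
  let u x := complex.Re (f x) in let v x := complex.Im (f x) in
  (I (cmeas_Re mu) u - I (cmeas_Im mu) v)
    +i* (I (cmeas_Re mu) v + I (cmeas_Im mu) u).

(* The D-torus, as a subspace of C^D with its Borel sigma-algebra. *)
Definition torus_set (R : realType) (D : nat) : set 'rV[R[i]^o]_D :=
  [set z | forall a, `|(z 0 a : R[i])| = 1].

Lemma torus_set1 (R : realType) (D : nat) :
  (const_mx 1 : 'rV[R[i]^o]_D) \in @torus_set R D.
Proof. by apply/mem_set => a; rewrite mxE normr1. Qed.

Definition torus (R : realType) (D : nat) := set_type (@torus_set R D).

HB.instance Definition _ (R : realType) (D : nat) :=
  Topological.on (torus R D).
HB.instance Definition _ (R : realType) (D : nat) :=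
  isPointed.Build (torus R D)
    (exist (fun z => z \in @torus_set R D) _ (torus_set1 R D)).

Definition borel_torus (R : realType) (D : nat) :=
  g_sigma_algebraType (@open (torus R D)).
HB.instance Definition _ (R : realType) (D : nat) :=
  Measurable.on (borel_torus R D).

Definition torus_val (R : realType) (D : nat) (t : borel_torus R D) :
  'rV[R[i]]_D := set_val (t : torus R D).

(* Multi-indices in Z^D; [D.-tuplelexi int] carries the lexicographic order. *)
Definition multi (D : nat) := D.-tuplelexi int.

Definition longitude (D : nat) (alpha : multi D) : nat :=
  (\sum_(a < D) `|tnth alpha a|)%N.

Definition monomial (R : realType) (D : nat) (z : 'rV[R[i]]_D)
    (alpha : multi D) : R[i] :=
  \prod_(a < D) z 0 a ^ tnth alpha a.

Definition block (D k : nat) : seq (multi D) :=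
  sort <=%O (fset_set [set alpha : multi D | longitude alpha = k]).

Lemma finite_longitude (D k : nat) :
  finite_set [set alpha : multi D | longitude alpha = k].
Proof.
pose g (f : {ffun 'I_D -> 'I_(k.*2.+1)}) : multi D :=
  [tuple (f a : nat)%:Z - k%:Z | a < D].
apply: (@sub_finite_set _ _ (g @` setT)); last exact: finite_image.
move=> alpha /= ak.
have ha a : (`|tnth alpha a| <= k)%N by rewrite -ak /longitude (bigD1 a) //= leq_addr.
exists [ffun a => inord (absz (tnth alpha a + k%:Z))] => //.
apply: eq_from_tnth => a; rewrite tnth_mktuple ffunE inordK.
  by have := ha a; lia.
by have := ha a; lia.
Qed.

Lemma mem_block (D k : nat) (alpha : multi D) :
  (alpha \in block D k) = (longitude alpha == k).
Proof.
rewrite mem_sort in_fset_set; last exact: finite_longitude.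
by apply/idP/eqP => [/set_mem|] // h; apply/mem_set.
Qed.

Lemma block_uniq (D k : nat) : uniq (block D k).
Proof. by rewrite sort_uniq fset_uniq. Qed.

Definition bsize (D k : nat) : nat := size (block D k).

Definition mindex (D k : nat) (i : 'I_(bsize D k)) : multi D :=
  tnth (in_tuple (block D k)) i.

(* Semi-infinite matrices and columns, given by their blocks [k], [l]. *)
Definition simx (R : realType) (D : nat) :=
  forall k l : nat, 'M[R[i]]_(bsize D k, bsize D l).

Definition sicol (R : realType) (D : nat) :=
  forall k : nat, 'cV[R[i]]_(bsize D k).

(* [\sum_(j \in [set: nat])] is the sum over the finite support of the summand
   (and 0 if the support is infinite).  The support is finite whenever the left
   factor is row-finite, e.g. block lower triangular. *)
Definition simul (R : realType) (D : nat) (A B : simx R D) : simx R D :=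
  fun k l => \sum_(j \in [set: nat]) (A k j *m B j l).

Definition simulc (R : realType) (D : nat) (A : simx R D) (v : sicol R D) :
    sicol R D :=
  fun k => \sum_(j \in [set: nat]) (A k j *m v j).

Definition siconj (R : realType) (D : nat) (A : simx R D) : simx R D :=
  fun k l => map_mx conjc (A k l).

Definition sitr (R : realType) (D : nat) (A : simx R D) : simx R D :=
  fun k l => (A l k)^T.

Definition siadj (R : realType) (D : nat) (A : simx R D) : simx R D :=
  siconj (sitr A).

Declare Scope simx_scope.
Delimit Scope simx_scope with SI.
Bind Scope simx_scope with simx.
Notation "A *b B" := (simul A B) (at level 40, left associativity) :
  simx_scope.
Notation "A *c v" := (simulc A v) (at level 40, left associativity) :
  simx_scope.
Local Open Scope simx_scope.

Definition siid (R : realType) (D : nat) : simx R D :=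
  fun k l => \matrix_(i, j) ((k == l) && (i == j :> nat))%:R.

Definition is_siinv (R : realType) (D : nat) (A B : simx R D) : Prop :=
  A *b B = siid R D /\ B *b A = siid R D.

Definition lower_unitriangular (R : realType) (D : nat) (A : simx R D) : Prop :=
  (forall k l, (k < l)%N -> A k l = 0) /\ (forall k, A k k = 1%:M).

Definition block_diagonal (R : realType) (D : nat) (A : simx R D) : Prop :=
  forall k l, k != l -> A k l = 0.

Definition first_subdiag (R : realType) (D : nat) (A : simx R D) : simx R D :=
  fun k l => if k == l.+1 then A k l else 0.

Definition sitrunc (R : realType) (D : nat) (k : nat) (A : simx R D) :
    'M[R[i]]_(\sum_(i < k) bsize D i) :=
  \mxblock_(i < k, j < k) A i j.

(* The k-th diagonal block is the exchange matrix of size [bsize D k]. *)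
Definition eta (R : realType) (D : nat) : simx R D :=
  fun k l => \matrix_(i, j) ((k == l) && ((i + j).+1 == bsize D k))%:R.

Definition chi (R : realType) (D : nat) (z : 'rV[R[i]]_D) : sicol R D :=
  fun k => \col_i monomial z (mindex i).

Definition moment_matrix (R : realType) (D : nat)
    (mu : complex_measure R (borel_torus R D)) : simx R D :=
  fun k l => \matrix_(i, j) complex_integral mu (fun t =>
    (chi (torus_val t) k *m map_mx conjc (chi (torus_val t) l)^T) i j).

Definition quasi_definite (R : realType) (D : nat)
    (mu : complex_measure R (borel_torus R D)) : Prop :=
  forall k, (0 < k)%N -> \det (sitrunc k (moment_matrix mu)) != 0.

(* G = S^-1 H (Sh^-1)^dagger.  A block lower unitriangular matrix has exactly
   one semi-infinite right inverse, which is again block lower unitriangular,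
   so [Si] and [Shi] are determined by S and Sh. *)
Definition gauss_borel (R : realType) (D : nat) (G S H Sh : simx R D) : Prop :=
  [/\ lower_unitriangular S, lower_unitriangular Sh,
      block_diagonal H /\ (forall k, H k k \in unitmx) &
      exists Si Shi : simx R D, [/\ is_siinv S Si, is_siinv Sh Shi &
        G = Si *b H *b siadj Shi]].

(* Phi(z) = S chi(z). *)
Definition polys (R : realType) (D : nat) (S : simx R D) (z : 'rV[R[i]]_D) :
    sicol R D :=
  S *c chi z.

Definition vinv (R : realType) (D : nat) (z : 'rV[R[i]]_D) : 'rV[R[i]]_D :=
  map_mx (fun x => x^-1) z.

(* Main.v *)
(** On the torus the moment G_{alpha,beta} only depends on alpha - beta, hence
    eta G eta = G^T, while G^dagger = G when the measure is real.  Transposing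
    (resp. taking adjoints in) G = S^-1 H (Sh^-1)^dagger thus yields a second
    block LDU factorization of the same matrix, and the factors agree by
    uniqueness.  The exchange matrix represents alpha |-> -alpha on each block,
    because negation reverses the lexicographic order; this gives
    eta chi(z) = chi(z^-1) and the statements on the polynomials. *)

Require Import Defs.
From mathcomp Require Import all_boot all_order all_algebra.
From mathcomp Require Import complex zify.
From mathcomp Require Import all_classical all_reals all_analysis.

Set Implicit Arguments.
Unset Strict Implicit.
Unset Printing Implicit Defensive.

Import Order.TTheory GRing.Theory Num.Theory.
Local Open Scope ring_scope.
Local Open Scope simx_scope.

(** * Negation of multi-indices and the order on each block *)

Section multi_opp.
Variable D : nat.
Implicit Types alpha beta : multi D.

Definition mopp alpha : multi D := [tuple - tnth alpha a | a < D].

Lemma tnth_mopp alpha a : tnth (mopp alpha) a = - tnth alpha a.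
Proof. by rewrite tnth_mktuple. Qed.

Lemma moppK : involutive mopp.
Proof. by move=> alpha; apply: eq_from_tnth => a; rewrite !tnth_mopp opprK. Qed.

Lemma longitude_mopp alpha : longitude (mopp alpha) = longitude alpha.
Proof. by apply: eq_bigr => a _; rewrite tnth_mopp abszN. Qed.

(** Each coordinate comparison is reversed, so the first difference decides the other way. Equal
    sizes matter: a proper prefix would stay smaller after negation. *)
Lemma seqlexi_opp (s t : seqlexi int) : size s = size t ->
  ((map -%R s : seqlexi int) <= map -%R t)%O = (t <= s)%O.
Proof.
elim: s t => [|x s IH] [|y t] //= [st].
by rewrite !lexi_cons !lerN2 IH.
Qed.

Lemma le_mopp alpha beta : (mopp alpha <= mopp beta)%O = (beta <= alpha)%O.
Proof.
have valE gamma : val (mopp gamma) = map -%R (val gamma).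
  rewrite /mopp /= -[X in _ = map _ X]map_tnth_enum -map_comp.
  by apply: eq_map => a.
rewrite -[LHS]/((val (mopp alpha) : seqlexi int) <= val (mopp beta))%O.
rewrite -[RHS]/((val beta : seqlexi int) <= val alpha)%O.
by rewrite !valE seqlexi_opp// !size_tuple.
Qed.

(** Both lists are sorted for the reversed order and have the same elements, because negation
    preserves longitude; a sorted list is determined by its elements. *)
Lemma rev_block k : rev (block D k) = map mopp (block D k).
Proof.
have sb : sorted <=%O (block D k) by exact/sort_sorted/le_total.
apply: (@sorted_eq _ (fun x y => (y <= x)%O)) => //.
- by move=> x y z xy yz; exact: le_trans yz xy.
- by move=> x y; rewrite andbC; exact: le_anti.
- by rewrite rev_sorted.
- rewrite sorted_map; apply: sub_sorted sb => x y /=.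
  by rewrite le_mopp.
rewrite perm_rev perm_sym; apply: uniq_perm.
- by rewrite map_inj_uniq ?block_uniq//; exact: inv_inj moppK.
- exact: block_uniq.
move=> x; rewrite -[x in LHS]moppK mem_map; last exact: inv_inj moppK.
by rewrite !mem_block longitude_mopp.
Qed.

Lemma mindex_rev_ord k (i : 'I_(bsize D k)) :
  mindex (rev_ord i) = mopp (mindex i).
Proof.
(* A default element for [nth]; the ordinal [i] witnesses that the block is nonempty. *)
have i0 := mindex i.
rewrite /mindex !(tnth_nth i0) /=.
rewrite -nth_rev// rev_block (nth_map i0)//.
Qed.

End multi_opp.

(** * Semi-infinite block matrices: finite sums, triangular inverses, uniqueness of LDU *)

Section semi_infinite.
Variables (R : realType) (D : nat).
Implicit Types (A B : simx R D) (v : sicol R D).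

Definition block_lower A := forall k l, (k < l)%N -> A k l = 0.

Lemma fsum_ord (V : nmodType) (m : nat) (f : nat -> V) :
  (forall j, (m <= j)%N -> f j = 0) ->
  (\sum_(j \in [set: nat]) f j = \sum_(j < m) f j)%R.
Proof.
move=> f0; rewrite (@fsbigE _ _ _ _ _ (index_iota 0 m)) ?iota_uniq//.
  by under eq_bigl do rewrite in_setT; rewrite big_mkord.
by move=> i _; rewrite mem_index_iota -leqNgt; exact: f0.
Qed.

Lemma simul_lowerE A B m k l : block_lower A -> (k < m)%N ->
  (A *b B) k l = \sum_(j < m) A k j *m B j l.
Proof.
move=> A0 km; rewrite /simul (@fsum_ord _ m)// => j mj.
by rewrite A0 ?mul0mx//; exact: leq_trans mj.
Qed.

Lemma simulc_lowerE A v k : block_lower A ->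
  (A *c v) k = \sum_(j < k.+1) A k j *m v j.
Proof.
move=> A0; rewrite /simulc (@fsum_ord _ k.+1)// => j mj.
by rewrite A0 ?mul0mx.
Qed.

Lemma sum_ord1 (V : nmodType) (m k : nat) (f : nat -> V) : (k < m)%N ->
  (forall j, j != k -> f j = 0) -> \sum_(j < m) f j = f k.
Proof.
move=> km f0; rewrite (bigD1 (Ordinal km))//= big1 ?addr0// => j jk.
by apply: f0.
Qed.

(** Row [k] of [A] may be infinite here; the sum is finite because column [l] of [B] has a single
    nonzero block. *)
Lemma simul_diagr A B k l : block_diagonal B -> (A *b B) k l = A k l *m B l l.
Proof.
move=> B0; rewrite /simul (@fsum_ord _ l.+1) => [|j lj].
  rewrite (@sum_ord1 _ _ l (fun j => A k j *m B j l))// => j jl.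
  by rewrite B0 ?mulmx0.
by rewrite B0 ?mulmx0// gtn_eqF.
Qed.

Lemma block_diagonal_lower A : block_diagonal A -> block_lower A.
Proof. by move=> A0 k l kl; rewrite A0// ltn_eqF. Qed.

Lemma simul_diagl A B k l : block_diagonal A -> (A *b B) k l = A k k *m B k l.
Proof.
move=> A0; rewrite (simul_lowerE _ _ (block_diagonal_lower A0) (ltnSn k)).
rewrite (@sum_ord1 _ _ k (fun j => A k j *m B j l))// => j jk.
by rewrite A0 1?eq_sym// mul0mx.
Qed.

Lemma simulc_diag A v k : block_diagonal A -> (A *c v) k = A k k *m v k.
Proof.
move=> A0; rewrite (simulc_lowerE _ _ (block_diagonal_lower A0)).
rewrite (@sum_ord1 _ _ k (fun j => A k j *m v j))// => j jk.
by rewrite A0 1?eq_sym// mul0mx.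
Qed.

Lemma siidE k : siid R D k k = 1%:M.
Proof. by apply/matrixP => i j; rewrite !mxE eqxx. Qed.

Lemma siid_diag : block_diagonal (siid R D).
Proof. by move=> k l /negPf kl; apply/matrixP => i j; rewrite !mxE kl. Qed.

(** Forward substitution: since [A k k] is the identity, row [k] of the product is [B k l] plus
    terms in earlier rows, which already agree. *)
Lemma simul_lcancel A B B' : lower_unitriangular A -> A *b B = A *b B' -> B = B'.
Proof.
move=> [A0 A1] AB; apply: functional_extensionality_dep => k.
apply: functional_extensionality_dep => l.
elim/ltn_ind: k => k IH.
have := congr1 (fun M : simx R D => M k l) AB.
rewrite !(simul_lowerE _ _ A0 (ltnSn k)) !big_ord_recr /= A1 !mul1mx.
under eq_bigr do rewrite IH//.
exact: addrI.
Qed.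

(** Forward substitution, run only on and above the diagonal: there the earlier rows of [B]
    contribute zero, so [B] agrees with the identity. *)
Lemma right_inverse_unitriangular A B : lower_unitriangular A ->
  A *b B = siid R D -> lower_unitriangular B.
Proof.
move=> [A0 A1] AB.
have BE k l : (k <= l)%N -> B k l = siid R D k l.
  elim/ltn_ind: k => k IH kl.
  have := congr1 (fun M : simx R D => M k l) AB.
  rewrite (simul_lowerE _ _ A0 (ltnSn k)) big_ord_recr /= A1 mul1mx.
  rewrite big1 ?add0r// => j _.
  have jl : (j < l)%N by exact: leq_trans kl.
  by rewrite IH// ?siid_diag ?mulmx0 ?ltn_eqF// ltnW.
split=> [k l kl|k]; first by rewrite BE ?siid_diag ?ltn_eqF// ltnW.
by rewrite BE// siidE.
Qed.

(** Block Gaussian elimination. Once the pivots before [n] are cancelled, row and column [n] hold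
    single products: the corner gives [d n], then its invertibility gives column [n] of [L] and row
    [n] of [U]. *)
Lemma ldu_unique (L L' U U' : simx R D) (d d' : forall k, 'M[R[i]]_(bsize D k)) :
  lower_unitriangular L -> lower_unitriangular L' ->
  lower_unitriangular (sitr U) -> lower_unitriangular (sitr U') ->
  (forall k, d k \in unitmx) ->
  (forall k l, \sum_(j < k.+1) L k j *m d j *m U j l =
               \sum_(j < k.+1) L' k j *m d' j *m U' j l) ->
  (forall k, d k = d' k) /\ L = L'.
Proof.
move=> [L0 L1] [L'0 L'1] [sU0 sU1] [sU'0 sU'1] du E.
have U0 k l : (l < k)%N -> U k l = 0.
  by move=> lk; apply: trmx_inj; rewrite [LHS]sU0 ?trmx0.
have U'0 k l : (l < k)%N -> U' k l = 0.
  by move=> lk; apply: trmx_inj; rewrite [LHS]sU'0 ?trmx0.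
have U1 k : U k k = 1%:M by apply: trmx_inj; rewrite [LHS]sU1 trmx1.
have U'1 k : U' k k = 1%:M by apply: trmx_inj; rewrite [LHS]sU'1 trmx1.
(* Terms with [j > n] vanish since [Y j l] lies strictly below the diagonal when [l <= n]. *)
have sumE (X Y : simx R D) (e : forall k, 'M[R[i]]_(bsize D k)) n k l :
    (forall k l, (l < k)%N -> Y k l = 0) -> (n <= k)%N -> (l <= n)%N ->
    \sum_(j < k.+1) X k j *m e j *m Y j l = \sum_(j < n.+1) X k j *m e j *m Y j l.
  move=> Y0 nk ln; rewrite -!(big_mkord xpredT (fun j => X k j *m e j *m Y j l)).
  rewrite (@big_cat_nat _ _ _ n.+1)//= [X in _ + X]big_nat_cond [X in _ + X]big1 ?addr0//.
  move=> j /andP[/andP[nj _] _].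
  by rewrite Y0 ?mulmx0//; exact: leq_ltn_trans nj.
(* The rows of [U] are carried along so that the induction hypothesis identifies whole summands. *)
suff H n : [/\ d n = d' n, forall k, L k n = L' k n & forall l, U n l = U' n l].
  split=> [k|]; first by have [] := H k.
  apply: functional_extensionality_dep => k.
  by apply: functional_extensionality_dep => l; have [] := H l.
elim/ltn_ind: n => n IH.
have F k l : (n <= k)%N -> (n <= l)%N -> (k == n) || (l == n) ->
    L k n *m d n *m U n l = L' k n *m d' n *m U' n l.
  move=> nk nl kln.
  have := E k l.
  have -> : \sum_(j < k.+1) L k j *m d j *m U j l =
            \sum_(j < n.+1) L k j *m d j *m U j l.
    case/orP: kln nl => /eqP-> // _; first exact: sumE.
  have -> : \sum_(j < k.+1) L' k j *m d' j *m U' j l =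
            \sum_(j < n.+1) L' k j *m d' j *m U' j l.
    case/orP: kln nl => /eqP-> // _; first exact: sumE.
  rewrite !big_ord_recr /=.
  under eq_bigr => j _ do have [-> -> ->] := IH j (ltn_ord j).
  exact: addrI.
have dn : d n = d' n.
  have := F n n (leqnn n) (leqnn n); rewrite eqxx => /(_ isT).
  by rewrite L1 L'1 U1 U'1 !mul1mx !mulmx1.
split=> // k.
- have [kn|nk] := ltnP k n; first by rewrite L0 ?L'0.
  have := F k n nk (leqnn n); rewrite eqxx orbT => /(_ isT).
  rewrite U1 U'1 !mulmx1 -dn => /(congr1 (mulmxr (invmx (d n)))) /=.
  by rewrite !mulmxK.
- have [kn|nk] := ltnP k n; first by rewrite U0 ?U'0.
  have := F n k (leqnn n) nk; rewrite eqxx => /(_ isT).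
  rewrite L1 L'1 !mul1mx -dn => /(congr1 (mulmx (invmx (d n)))) /=.
  by rewrite !mulKmx.
Qed.

(** * Conjugation by the exchange matrix, and entrywise complex conjugation *)

Lemma eta_diag : block_diagonal (eta R D).
Proof. by move=> k l /negPf kl; apply/matrixP => i j; rewrite !mxE kl. Qed.

Lemma etaE k (i j : 'I_(bsize D k)) : eta R D k k i j = (j == rev_ord i)%:R.
Proof.
rewrite mxE eqxx /= -val_eqE /=; congr (nat_of_bool _)%:R.
have := ltn_ord i; have := ltn_ord j.
move: (bsize D k) (nat_of_ord i) (nat_of_ord j) => n a b an bn.
by apply/eqP/eqP; lia.
Qed.

Lemma eta_tr k : (eta R D k k)^T = eta R D k k.
Proof.
apply/matrixP => i j; rewrite mxE !etaE; congr (nat_of_bool _)%:R.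
by rewrite -(inj_eq rev_ord_inj) rev_ordK eq_sym.
Qed.

Lemma eta_mull k p (M : 'M[R[i]]_(bsize D k, p)) i j :
  (eta R D k k *m M) i j = M (rev_ord i) j.
Proof.
rewrite mxE (bigD1 (rev_ord i))//= etaE eqxx mul1r big1 ?addr0// => a ai.
by rewrite etaE (negPf ai) mul0r.
Qed.

Lemma eta_mulr k p (M : 'M[R[i]]_(p, bsize D k)) i j :
  (M *m eta R D k k) i j = M i (rev_ord j).
Proof.
by rewrite -[M *m _]trmxK mxE trmx_mul eta_tr eta_mull mxE.
Qed.

Lemma etaK k : eta R D k k *m eta R D k k = 1%:M.
Proof.
by apply/matrixP => i j; rewrite eta_mull etaE rev_ordK mxE eq_sym.
Qed.

Definition eta_conj A : simx R D := eta R D *b A *b eta R D.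

Lemma eta_conjE A k l : eta_conj A k l = eta R D k k *m A k l *m eta R D l l.
Proof.
by rewrite /eta_conj simul_diagr ?simul_diagl//; exact: eta_diag.
Qed.

Lemma eta_conj_unitriangular A :
  lower_unitriangular A -> lower_unitriangular (eta_conj A).
Proof.
move=> [A0 A1]; split=> [k l kl|k]; rewrite eta_conjE.
  by rewrite A0// mulmx0 mul0mx.
by rewrite A1 mulmx1 etaK.
Qed.

(** Insert [etaK] between the factors; triangularity of [A] makes both products finite sums over the
    same range. *)
Lemma eta_conj_mul A B : block_lower A ->
  eta_conj (A *b B) = eta_conj A *b eta_conj B.
Proof.
move=> A0; apply: functional_extensionality_dep => k.
apply: functional_extensionality_dep => l.
have cA0 : block_lower (eta_conj A).
  by move=> a b ab; rewrite eta_conjE A0// mulmx0 mul0mx.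
rewrite eta_conjE (simul_lowerE _ _ A0 (ltnSn k)) (simul_lowerE _ _ cA0 (ltnSn k)).
rewrite mulmx_sumr mulmx_suml; apply: eq_bigr => j _.
by rewrite !eta_conjE !mulmxA -[_ *m eta R D j j *m eta R D j j]mulmxA etaK mulmx1.
Qed.

Lemma eta_conj_id : eta_conj (siid R D) = siid R D.
Proof.
apply: functional_extensionality_dep => k.
apply: functional_extensionality_dep => l; rewrite eta_conjE.
have [->|kl] := eqVneq k l; first by rewrite siidE mulmx1 etaK.
by rewrite siid_diag// mulmx0 mul0mx.
Qed.

Lemma siconj_unitriangular A :
  lower_unitriangular A -> lower_unitriangular (siconj A).
Proof.
move=> [A0 A1]; split=> [k l kl|k]; rewrite /siconj.
  by rewrite A0// map_mx0.
by rewrite A1 map_mx1.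
Qed.

Lemma siconj_mul A B : block_lower A -> siconj (A *b B) = siconj A *b siconj B.
Proof.
move=> A0; apply: functional_extensionality_dep => k.
apply: functional_extensionality_dep => l.
have cA0 : block_lower (siconj A) by move=> a b ab; rewrite /siconj A0// map_mx0.
rewrite (simul_lowerE _ _ cA0 (ltnSn k)) /siconj (simul_lowerE _ _ A0 (ltnSn k)).
by rewrite map_mx_sum; apply: eq_bigr => j _; rewrite map_mxM.
Qed.

Lemma siconj_id : siconj (siid R D) = siid R D.
Proof.
apply: functional_extensionality_dep => k.
apply: functional_extensionality_dep => l; rewrite /siconj.
have [->|kl] := eqVneq k l; first by rewrite siidE map_mx1.
by rewrite siid_diag// map_mx0.
Qed.

Lemma siconjK : involutive (@siconj R D).
Proof.
move=> A; apply: functional_extensionality_dep => k.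
apply: functional_extensionality_dep => l; apply/matrixP => i j.
by rewrite !mxE conjcK.
Qed.

Lemma eta_conjK : involutive eta_conj.
Proof.
move=> A; apply: functional_extensionality_dep => k.
apply: functional_extensionality_dep => l.
by rewrite !eta_conjE !mulmxA etaK mul1mx -mulmxA etaK mulmx1.
Qed.

Lemma eta_conj_siconj A : eta_conj (siconj A) = siconj (eta_conj A).
Proof.
apply: functional_extensionality_dep => k.
apply: functional_extensionality_dep => l.
rewrite /siconj !eta_conjE; apply/matrixP => i j.
by rewrite !(eta_mulr, eta_mull, mxE).
Qed.

End semi_infinite.

(** * Integration against charges, and conjugation under a real measure *)

Section real_charge_integral.
Variables (R : realType) (d : measure_display) (T : measurableType d).

(* No integrability is needed: [fine] sends both infinities, hence also the
   junk value of [+oo - +oo], to 0. *)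
Lemma RintegralN_total (m : {measure set T -> \bar R}) (f : T -> R) :
  \int[m]_x (- f x) = - \int[m]_x f x.
Proof.
rewrite /Rintegral.
have -> : (fun x => (- f x)%:E) = (\- (fun x => (f x)%:E))%E by [].
rewrite integralE funeposN funenegN [in RHS]integralE.
move: (\int[m]_x _)%E (\int[m]_x _)%E => [a| |] [b| |] //=; rewrite ?oppr0//.
by rewrite opprB.
Qed.

Lemma charge_integralN (nu : {charge set T -> \bar R}) (f : T -> R) :
  charge_integral nu (fun x => - f x) = - charge_integral nu f.
Proof. by rewrite /charge_integral !RintegralN_total opprB opprK addrC. Qed.

(** Both Jordan parts are, up to sign, restrictions of [nu] to Hahn sets, so they vanish on
    measurable sets. This disposes of the imaginary part of a real measure. *)
Lemma charge_integral0 (nu : {charge set T -> \bar R}) (f : T -> R) :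
  (forall A, measurable A -> nu A = 0%E) -> charge_integral nu f = 0.
Proof.
move=> nu0; rewrite /charge_integral.
set hP := cid _; set hN := cid _.
have zero (m : {measure set T -> \bar R}) :
    (forall A, measurable A -> m A = 0%E) -> \int[m]_x f x = 0.
  move=> m0; rewrite /Rintegral (@eq_measure_integral _ _ _ _ mzero) => [|A mA _].
    by rewrite integral_measure_zero.
  by rewrite m0.
have [[mP _] [mN _] _ _] := projT2 hN.
rewrite !zero ?subr0// => A mA.
- rewrite [LHS]jordan_negE cjordan_negE /crestr0 mem_set//= /crestr nu0 ?oppe0//.
  exact: measurableI.
- rewrite [LHS]jordan_posE cjordan_posE /crestr0 mem_set//= /crestr nu0//.
  exact: measurableI.
Qed.

Lemma complex_integral_conj (mu : complex_measure R T) (f : T -> R[i]) :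
  real_measure mu ->
  complex_integral mu (fun x => conjc (f x)) = conjc (complex_integral mu f).
Proof.
move=> mu_real; rewrite /complex_integral /=.
have -> : (fun x => complex.Re (conjc (f x))) = (fun x => complex.Re (f x)).
  by apply/funext => x; case: (f x).
have -> : (fun x => complex.Im (conjc (f x))) = (fun x => - complex.Im (f x)).
  by apply/funext => x; case: (f x).
have Im0 g : charge_integral (cmeas_Im mu) g = 0.
  by apply: charge_integral0 => A mA; have := congr1 EFin (mu_real A mA).
by rewrite !Im0 charge_integralN !subr0 !addr0.
Qed.

End real_charge_integral.

(** * Symmetries of monomials and of the moment matrix *)

Section moments.
Variables (R : realType) (D : nat).
Implicit Types (z : 'rV[R[i]]_D) (alpha : multi D).

Lemma monomial_mopp z alpha : monomial z (mopp alpha) = monomial (vinv z) alpha.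
Proof. by apply: eq_bigr => a _; rewrite tnth_mopp mxE exprz_inv. Qed.

Lemma monomial_conj z alpha :
  conjc (monomial z alpha) = monomial (map_mx conjc z) alpha.
Proof.
by rewrite /monomial rmorph_prod; apply: eq_bigr => a _; rewrite mxE fmorphXz.
Qed.

Lemma vinv_torus (t : borel_torus R D) :
  vinv (torus_val t) = map_mx conjc (torus_val t).
Proof.
(* The inverse is the conjugate divided by the squared modulus, which is 1 on the torus. *)
apply/rowP => a; rewrite !mxE invc_norm.
have := set_mem (valP (t : torus R D)); move=> /(_ a) => t1.
by rewrite [`|_|]t1 expr1n invr1 mul1r.
Qed.

Lemma eta_chi z k : eta R D k k *m chi z k = chi (vinv z) k.
Proof.
by apply/matrixP => i j; rewrite eta_mull !mxE mindex_rev_ord monomial_mopp.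
Qed.

Lemma moment_matrixE (mu : complex_measure R (borel_torus R D)) k l i j :
  moment_matrix mu k l i j = complex_integral mu (fun t =>
    monomial (torus_val t) (mindex i) * conjc (monomial (torus_val t) (mindex j))).
Proof.
rewrite mxE; congr complex_integral; apply: funext => t.
by rewrite !mxE big_ord1 !mxE.
Qed.

(** Negating both exponents conjugates both factors of the integrand on the torus, which exchanges
    the roles of row and column. *)
Lemma eta_moment_matrix (mu : complex_measure R (borel_torus R D)) :
  eta_conj (moment_matrix mu) = sitr (moment_matrix mu).
Proof.
apply: functional_extensionality_dep => k.
apply: functional_extensionality_dep => l; apply/matrixP => i j.
rewrite eta_conjE eta_mulr eta_mull [RHS]mxE !moment_matrixE.
congr complex_integral; apply: funext => t.
rewrite !mindex_rev_ord !monomial_mopp vinv_torus -!monomial_conj conjcK.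
by rewrite mulrC.
Qed.

Lemma moment_matrix_hermitian (mu : complex_measure R (borel_torus R D)) :
  real_measure mu -> siadj (moment_matrix mu) = moment_matrix mu.
Proof.
move=> mu_real; apply: functional_extensionality_dep => k.
apply: functional_extensionality_dep => l; apply/matrixP => i j.
have -> : siadj (moment_matrix mu) k l i j = conjc (moment_matrix mu l k j i).
  by rewrite !mxE.
rewrite !moment_matrixE.
rewrite -complex_integral_conj//; congr complex_integral; apply: funext => t.
by rewrite rmorphM /= conjcK mulrC.
Qed.

End moments.

(** * Products of the form LDU: uniqueness and transposition *)

Section ldu_factorization.
Variables (R : realType) (D : nat).
Implicit Types A L H U : simx R D.

Lemma sitrK : involutive (@sitr R D).
Proof.
move=> A; apply: functional_extensionality_dep => k.
by apply: functional_extensionality_dep => l; exact: trmxK.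
Qed.

Lemma sitr_siadj A : sitr (siadj A) = siconj A.
Proof.
apply: functional_extensionality_dep => k.
apply: functional_extensionality_dep => l; apply/matrixP => i j.
by rewrite !mxE.
Qed.

Lemma ldu_mulE L H U k l : block_lower L -> block_diagonal H ->
  (L *b H *b U) k l = \sum_(j < k.+1) L k j *m H j j *m U j l.
Proof.
move=> L0 H0; have LH0 : block_lower (L *b H).
  by move=> a b ab; rewrite simul_diagr// L0// mul0mx.
rewrite (simul_lowerE _ _ LH0 (ltnSn k)).
by apply: eq_bigr => j _; rewrite simul_diagr.
Qed.

Lemma ldu_mul_unique L L' H H' U U' :
  lower_unitriangular L -> lower_unitriangular L' ->
  lower_unitriangular (sitr U) -> lower_unitriangular (sitr U') ->
  block_diagonal H -> block_diagonal H' -> (forall k, H k k \in unitmx) ->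
  L *b H *b U = L' *b H' *b U' -> H = H' /\ L = L'.
Proof.
move=> lL lL' lU lU' H0 H'0 Hu E.
have E' k l : \sum_(j < k.+1) L k j *m H j j *m U j l =
              \sum_(j < k.+1) L' k j *m H' j j *m U' j l.
  have := congr1 (fun M : simx R D => M k l) E.
  by rewrite !ldu_mulE//; [exact: (proj1 lL') | exact: (proj1 lL)].
have [HH' ->] := @ldu_unique _ _ _ _ _ _ _ (fun k => H' k k) lL lL' lU lU' Hu E'.
split=> //; apply: functional_extensionality_dep => k.
apply: functional_extensionality_dep => l.
by have [->|kl] := eqVneq k l; rewrite ?HH'// H0 ?H'0.
Qed.

(** The triangular sums stop at the row index, which is [l] on the left and [k] on the right;
    triangularity of both outer factors cuts each of them at [minn k l]. *)
Lemma sitr_ldu L H U : block_lower L -> block_lower (sitr U) ->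
  block_diagonal H -> sitr (L *b H *b U) = sitr U *b sitr H *b sitr L.
Proof.
move=> L0 U0 H0.
have H'0 : block_diagonal (sitr H) by move=> k l kl; rewrite /sitr H0 ?trmx0 1?eq_sym.
apply: functional_extensionality_dep => k; apply: functional_extensionality_dep => l.
pose F j := sitr U k j *m sitr H j j *m sitr L j l.
have F0 m : (minn k l < m)%N -> \sum_(j < m) F j = \sum_(j < (minn k l).+1) F j.
  move=> klm; rewrite -!(big_mkord xpredT F).
  rewrite (@big_cat_nat _ _ _ (minn k l).+1)//= [X in _ + X]big_nat_cond.
  rewrite [X in _ + X]big1 ?addr0// => j /andP[/andP[+ _] _].
  rewrite gtn_min => /orP[kj|lj]; first by rewrite /F U0// !mul0mx.
  by rewrite /F [X in _ *m X]/sitr L0// trmx0 mulmx0.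
rewrite ldu_mulE// -/F F0 ?ltnS ?geq_minl// -(F0 l.+1) ?ltnS ?geq_minr//.
rewrite [LHS]/sitr ldu_mulE// [LHS]linear_sum; apply: eq_bigr => j _.
by rewrite /F /= !trmx_mul mulmxA.
Qed.

End ldu_factorization.

(** * Comparison of the factorizations, and the three groups of identities *)

Theorem proposition2p13 (R : realType) (D : nat) (hD : (0 < D)%N)
    (mu : complex_measure R (borel_torus R D)) (S H Sh : simx R D)
    (hmu : quasi_definite mu)
    (hfact : gauss_borel (moment_matrix mu) S H Sh) :
  [/\ [/\ eta R D *b H *b eta R D = sitr H,
          siconj Sh = eta R D *b S *b eta R D &
          real_measure mu -> eta R D *b H *b eta R D = siconj H],
      eta R D *b first_subdiag S *b eta R D = siconj (first_subdiag Sh) &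
      forall z : 'rV[R[i]]_D, (forall a, z 0 a != 0) ->
        eta R D *c polys S z = polys (siconj Sh) (vinv z) /\
        eta R D *c polys Sh z = polys (siconj S) (vinv z)].
Proof.
have [lS lSh [H0 Hu] [Si [Shi [[SSi SiS] [ShShi ShiSh] GE]]]] := hfact.
have lSi := right_inverse_unitriangular lS SSi.
have lShi := right_inverse_unitriangular lSh ShShi.
have lShiJ := siconj_unitriangular lShi.
have lU : lower_unitriangular (sitr (siadj Shi)) by rewrite sitr_siadj.
have HT0 : block_diagonal (sitr H).
  by move=> k l kl; rewrite /sitr H0 ?trmx0 1?eq_sym.
(* Transposition turns the upper factor [siadj Shi] into the lower factor [siconj Shi]. *)
have trG : sitr (moment_matrix mu) = siconj Shi *b sitr H *b sitr Si.
  by rewrite GE sitr_ldu ?sitr_siadj//; [exact: (proj1 lSi)|exact: (proj1 lShiJ)].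
(* Conjugation by [eta] is multiplicative and preserves lower and upper triangularity, so the order
   of the factors stays. *)
have etaG : eta_conj (moment_matrix mu) =
    eta_conj Si *b eta_conj H *b eta_conj (siadj Shi).
  rewrite GE !eta_conj_mul//; first exact: (proj1 lSi).
  by move=> k l kl; rewrite simul_diagr// (proj1 lSi)// mul0mx.
have etaH0 : block_diagonal (eta_conj H).
  by move=> k l kl; rewrite eta_conjE H0// mulmx0 mul0mx.
have etaHu k : eta_conj H k k \in unitmx.
  have [Eu _] := mulmx1_unit (etaK R D k).
  by rewrite eta_conjE !unitmx_mul Eu Hu.
have lEU : lower_unitriangular (sitr (eta_conj (siadj Shi))).
  rewrite (_ : sitr _ = eta_conj (siconj Shi)); first exact: eta_conj_unitriangular.
  apply: functional_extensionality_dep => k.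
  apply: functional_extensionality_dep => l.
  rewrite -sitr_siadj [LHS]/sitr !eta_conjE !trmx_mul !eta_tr.
  by rewrite mulmxA.
have [etaHE etaSi] : eta_conj H = sitr H /\ eta_conj Si = siconj Shi.
  apply: (ldu_mul_unique (eta_conj_unitriangular lSi) lShiJ lEU _ etaH0 HT0 etaHu
    (U' := sitr Si)).
    by rewrite sitrK.
  by rewrite -etaG -trG eta_moment_matrix.
(* Both sides are right inverses of [siconj Shi], which equals [eta_conj Si]. *)
have etaS : siconj Sh = eta_conj S.
  apply: (simul_lcancel lShiJ).
  rewrite -[LHS]siconj_mul ?ShiSh; last exact: (proj1 lShi).
  rewrite -etaSi -[RHS]eta_conj_mul ?SiS; last exact: (proj1 lSi).
  by rewrite siconj_id eta_conj_id.
(* Inserting the square of [eta] between [A] and [chi z] leaves [eta_conj A] acting on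
   [chi (vinv z)]. *)
have polysE A z : block_lower A ->
    eta R D *c polys A z = polys (eta_conj A) (vinv z).
  move=> A0; have cA0 : block_lower (eta_conj A).
    by move=> a b ab; rewrite eta_conjE A0// mulmx0 mul0mx.
  apply: functional_extensionality_dep => k.
  rewrite simulc_diag; last exact: eta_diag.
  rewrite /polys !simulc_lowerE// mulmx_sumr; apply: eq_bigr => j _.
  by rewrite eta_conjE -eta_chi -!mulmxA (mulmxA (eta R D j j)) etaK mul1mx.
split; first split=> // mu_real.
- rewrite -/(eta_conj H) etaHE.
  have HJ0 : block_diagonal (siadj H).
    by move=> k l kl; rewrite /siadj /siconj HT0 ?map_mx0.
  (* The moment matrix is Hermitian, so its adjoint factorization has lower factor [Shi] and
     diagonal [siadj H]; uniqueness makes [H] Hermitian, and its transpose is then its conjugate. *)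
  have [HE _] : H = siadj H /\ Si = Shi.
    apply: (ldu_mul_unique lSi lShi lU _ H0 HJ0 Hu (U' := siadj Si)).
      by rewrite sitr_siadj; exact: siconj_unitriangular.
    rewrite -GE -[LHS]moment_matrix_hermitian// /siadj trG.
    rewrite siconj_mul; last first.
      by move=> k l kl; rewrite simul_diagr// (proj1 lShiJ)// mul0mx.
    by rewrite siconj_mul ?siconjK//; exact: (proj1 lShiJ).
  by rewrite {1}HE sitr_siadj.
(* Conjugation by the block diagonal [eta] keeps every block in place, so [etaS] restricts to the
   subdiagonal. *)
- rewrite -/(eta_conj _); apply: functional_extensionality_dep => k.
  apply: functional_extensionality_dep => l.
  rewrite eta_conjE /siconj /first_subdiag; case: ifP => _.
    by rewrite -eta_conjE -etaS.
  by rewrite mulmx0 mul0mx map_mx0.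
move=> z _; split; rewrite polysE ?etaS//; [exact: (proj1 lS)| |exact: (proj1 lSh)].
(* Conjugating [etaS] entrywise gives [eta_conj Sh = siconj S], since [eta] is real and [eta_conj]
   is an involution. *)
by rewrite -[Sh]siconjK etaS eta_conj_siconj eta_conjK.
Qed.
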